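(* Let $\Omega$ be a finite ground set, $f:2^\Omega\to\mathbb{R}_{\ge0}$ a (possibly nonmonotone) submodular function, $\rho$ a routing-based cost function on $2^\Omega$, $\mathbf{c}>0$ a budget, $\theta>0$, and $\hat\rho$ a $(1+\theta)$-approximation algorithm for $\rho$. Fix $S\subseteq\Omega$. Let $X^{\hat\rho}$ be the output of the greedy loop on $S$ with evaluator $\hat\rho$ and budget $(1+\theta)\mathbf{c}$, and let $X^{\rho}$ be the output of the greedy loop on $S$ with evaluator $\rho$ and budget $\mathbf{c}$. Then $X^{\rho}\subseteq X^{\hat\rho}\subseteq S$, for any $\theta>0$.
   Context: $f$ is submodular: $f(A\cup B)+f(A\cap B)\le f(A)+f(B)$ for all $A,B\subseteq\Omega$; the marginal gain is $f^+_A(x)=f(A\cup\{x\})-f(A)$. Routing-based cost function: the items of $\Omega$ are vertices of a weighted graph with visiting costs $c_s\ge 0$ and positive edge weights, and $\rho(S)=\sum_{s\in S}c_s+r^*(S)$ where $r^*(S)$ is the minimum cost of a route traversing each vertex of $S$ at least once; $\rho(\emptyset)=0$ and $\rho$ is nondecreasing. $\hat\rho$ is a $(1+\theta)$-approximation of $\rho$: $\rho(S')\le\hat\rho(S')\le(1+\theta)\rho(S')$ for all $S'\subseteq\Omega$. Greedy loop on $S$ with evaluator $C$ and budget $B$: start with the empty sequence $X$ and $R=S$; while $R\neq\emptyset$, let $s^*=\arg\max\{f^+_X(s): s\in R\}$ (with a fixed tie-breaking rule not depending on $C$); if $C(X\cup\{s^*\})\le B$, append $s^*$ to $X$ and remove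 it from $R$; otherwise stop. The output is the final $X$. *)

(* Defs.v *)
(* The real numbers are abstracted to an arbitrary realFieldType. *)
From mathcomp Require Import all_boot all_order all_algebra.

Set Implicit Arguments.
Unset Strict Implicit.
Unset Printing Implicit Defensive.

Import Order.TTheory GRing.Theory Num.Theory.
Local Open Scope ring_scope.

Section SetFunctions.

Variables (R : realFieldType) (Omega : finType).
Implicit Types (f : {set Omega} -> R) (A B X : {set Omega}).

Definition submodular f : Prop :=
  forall A B, f (A :|: B) + f (A :&: B) <= f A + f B.

Definition marginal_gain f A (x : Omega) : R := f (x |: A) - f A.

Definition approximation (theta : R) (rho rhoh : {set Omega} -> R) : Prop :=
  forall A, rho A <= rhoh A /\ rhoh A <= (1 + theta) * rho A.

End SetFunctions.

Record weighted_graph (R : realFieldType) (V : finType) := WeightedGraph {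
  edge : rel V;
  weight : V -> V -> R;
  edge_sym : symmetric edge;
  edge_irr : irreflexive edge;
  weight_sym : forall u v, weight u v = weight v u;
  weight_gt0 : forall u v, edge u v -> 0 < weight u v
}.

Section Routing.

Variables (R : realFieldType) (V : finType) (G : weighted_graph R V).
Implicit Types (closed : bool) (p : seq V) (S : {set V}).

(* A route is a walk, given by its successive vertices; vertices and edges may
   be repeated. When [closed] holds it must also end where it started. The
   empty route and the one-vertex routes are allowed and cost 0. *)
Definition route closed p : bool :=
  if p is x :: q then path (edge G) x q && (closed ==> (last x q == x))
  else true.

Definition route_cost p : R :=
  \sum_(e <- zip p (behead p)) weight G e.1 e.2.

Definition route_through closed S p : Prop :=
  route closed p /\ {subset S <= p}.

(* The minimum is stated to exist and to be attained; in particular the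
   vertices of S must be joined by some route. *)
Definition is_min_route_cost closed S (r : R) : Prop :=
  (exists2 p, route_through closed S p & route_cost p = r) /\
  (forall p, route_through closed S p -> r <= route_cost p).

(* The items are identified with vertices of G through [loc] (to be taken
   injective); G may have further vertices that are not items. *)
Definition routing_cost closed (Omega : finType) (loc : Omega -> V)
    (c : Omega -> R) (rho : {set Omega} -> R) : Prop :=
  forall A : {set Omega}, exists2 r,
    is_min_route_cost closed (loc @: A) r & rho A = \sum_(s in A) c s + r.

Lemma route_cost_ge0 closed p : route closed p -> 0 <= route_cost p.
Proof.
rewrite /route_cost; case: p => [|x q] /=; first by rewrite big_nil.
case/andP=> + _; elim: q x => [|y q IHq] x /=; first by rewrite big_nil.
case/andP=> xy yq; rewrite big_cons /= addr_ge0 ?IHq //.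
exact/ltW/weight_gt0.
Qed.

Lemma routing_cost0 closed (Omega : finType) (loc : Omega -> V) c rho :
  routing_cost closed loc c rho -> rho set0 = 0.
Proof.
move=> /(_ set0)[r [[p [rp _] <-] rmin] ->]; rewrite big_set0 add0r.
apply/eqP; rewrite eq_le (route_cost_ge0 rp) andbT.
have -> : 0 = route_cost [::] by rewrite /route_cost big_nil.
by apply: rmin; split=> // v; rewrite imset0 inE.
Qed.

Lemma routing_cost_mono closed (Omega : finType) (loc : Omega -> V) c rho :
    (forall s, 0 <= c s) -> routing_cost closed loc c rho ->
  forall A B : {set Omega}, A \subset B -> rho A <= rho B.
Proof.
move=> c0 rhoP A B sAB; have [r [_ rmin] ->] := rhoP A.
have [_ [[p [rp Bp] <-] _] ->] := rhoP B; apply: lerD.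
  rewrite [leRHS](big_setID A) /= (setIidPr sAB) lerDl.
  by apply: sumr_ge0 => s _; apply: c0.
apply: rmin; split=> // v Av; apply: Bp.
exact: (subsetP (imsetS loc sAB)).
Qed.

End Routing.

Section Greedy.

Variables (R : realFieldType) (Omega : finType).
Variable f : {set Omega} -> R.

(* [tie X M] picks one element of the set M of maximizers; it may depend on the
   sequence X of the items chosen so far, but takes no evaluator. The option
   accommodates an empty ground set. *)
Variable tie : seq Omega -> {set Omega} -> option Omega.

Definition tie_breaking : Prop :=
  forall X (M : {set Omega}), M != set0 -> exists2 s, tie X M = Some s & s \in M.

Definition best_items (X : seq Omega) (Q : {set Omega}) : {set Omega} :=
  [set s in Q | [forall t in Q,
     marginal_gain f [set x in X] t <= marginal_gain f [set x in X] s]].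

(* Evaluator C, budget B, current sequence X, remaining items Q. Every
   iteration removes an item from Q, so #|Q| steps suffice: see greedy_runE. *)
Fixpoint greedy_loop (C : {set Omega} -> R) (B : R)
    (n : nat) (X : seq Omega) (Q : {set Omega}) : seq Omega :=
  if n is n'.+1 then
    if Q == set0 then X else
    if tie X (best_items X Q) is Some s then
      if C (s |: [set x in X]) <= B
      then greedy_loop C B n' (rcons X s) (Q :\ s)
      else X
    else X
  else X.

Definition greedy_run C B X (Q : {set Omega}) := greedy_loop C B #|Q| X Q.

Definition greedy C B (S : {set Omega}) : seq Omega := greedy_run C B [::] S.

Lemma best_items_neq0 X (Q : {set Omega}) : Q != set0 -> best_items X Q != set0.
Proof.
case/set0Pn=> s0 Qs0; apply/set0Pn.
case: (arg_maxP (marginal_gain f [set x in X]) Qs0) => s Qs smax.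
by exists s; rewrite inE; apply/andP; split=> //; apply/forall_inP.
Qed.

Lemma greedy_runE C B X (Q : {set Omega}) : tie_breaking ->
  greedy_run C B X Q =
    if Q == set0 then X else
    if tie X (best_items X Q) is Some s then
      if C (s |: [set x in X]) <= B then greedy_run C B (rcons X s) (Q :\ s)
      else X
    else X.
Proof.
move=> tieP; rewrite /greedy_run; case: (eqVneq Q set0) => [->|Q0].
  by rewrite cards0.
have [s Es] := tieP X _ (best_items_neq0 X Q0).
rewrite inE => /andP[Qs _].
by rewrite (cardsD1 s Q) Qs add1n /= (negPf Q0) Es.
Qed.

End Greedy.

(* Main.v *)
(* With the same tie-breaking rule both loops propose the same item as long as
   neither has stopped, and any item accepted by rho within the budget is
   accepted by rhoh within (1 + theta) times the budget. Hence the run with rho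
   is a prefix of the run with rhoh. *)

Require Import Defs.
From mathcomp Require Import all_boot all_order all_algebra.

Set Implicit Arguments.
Unset Strict Implicit.
Unset Printing Implicit Defensive.

Import Order.TTheory GRing.Theory Num.Theory.
Local Open Scope ring_scope.

Section GreedyLoop.

Variables (R : realFieldType) (Omega : finType) (f : {set Omega} -> R).
Variable tie : seq Omega -> {set Omega} -> option Omega.
Implicit Types (C : {set Omega} -> R) (X : seq Omega) (Q : {set Omega}).

(** An iteration either stops or appends to [X]. This covers the phase where one loop has stopped at
    [X] while the other may go on. *)
Lemma prefix_greedy_loop C B n X Q : prefix X (greedy_loop f tie C B n X Q).
Proof.
elim: n X Q => [|n IHn] X Q /=; first exact: prefix_refl.
case: ifP => _; first exact: prefix_refl.
case: (tie _ _) => [s|]; last exact: prefix_refl.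
case: ifP => _; last exact: prefix_refl.
exact: prefix_trans (prefix_rcons X s) (IHn _ _).
Qed.

Lemma greedy_loop_prefix C C' B B' n X Q :
    (forall A, C A <= B -> C' A <= B') ->
  prefix (greedy_loop f tie C B n X Q) (greedy_loop f tie C' B' n X Q).
Proof.
move=> leCC'; elim: n X Q => [|n IHn] X Q /=; first exact: prefix_refl.
case: ifP => _; first exact: prefix_refl.
case: (tie _ _) => [s|]; last exact: prefix_refl.
(* When both accept [s], they recurse from the same state and the induction hypothesis applies. *)
case: ifP => [/leCC' -> // | _].
(* Here [C] has rejected [s]: its output is [X], which the other loop can only extend. *)
case: ifP => _; last exact: prefix_refl.
exact: prefix_trans (prefix_rcons X s) (prefix_greedy_loop _ _ _ _ _).
Qed.

(** [X] is arbitrary because the induction passes to [rcons X s]; [tie_breaking] ensures that [s]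
    comes from [Q]. *)
Lemma greedy_loop_sub C B n X Q : tie_breaking tie ->
  {subset greedy_loop f tie C B n X Q <= [predU X & Q]}.
Proof.
move=> tieP; elim: n X Q => [|n IHn] X Q x /=; first by rewrite inE => ->.
have XQ : x \in X -> x \in [predU X & Q] by rewrite inE => ->.
case: (eqVneq Q set0) => [_ /XQ //|Q0].
have [s -> ] := tieP X _ (best_items_neq0 f X Q0).
rewrite inE => /andP[Qs _]; case: ifP => [_ /IHn|_ /XQ //].
rewrite !inE mem_rcons inE -orbA.
by case/or3P=> [/eqP->|->//|/andP[_ ->]]; rewrite ?Qs orbT.
Qed.

End GreedyLoop.

Theorem theorem2 (R : realFieldType) (Omega : finType)
    (f : {set Omega} -> R)
    (f_ge0 : forall A, 0 <= f A) (f_submod : submodular f)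
    (V : finType) (G : weighted_graph R V) (closed : bool)
    (loc : Omega -> V) (loc_inj : injective loc)
    (c : Omega -> R) (c_ge0 : forall s, 0 <= c s)
    (rho : {set Omega} -> R) (rhoP : routing_cost G closed loc c rho)
    (budget : R) (budget_gt0 : 0 < budget)
    (theta : R) (theta_gt0 : 0 < theta)
    (rhoh : {set Omega} -> R) (rhohP : approximation theta rho rhoh)
    (tie : seq Omega -> {set Omega} -> option Omega) (tieP : tie_breaking tie)
    (S : {set Omega}) :
  [set x in greedy f tie rho budget S]
    \subset [set x in greedy f tie rhoh ((1 + theta) * budget) S] /\
  [set x in greedy f tie rhoh ((1 + theta) * budget) S] \subset S.
Proof.
split; apply/subsetP=> x; rewrite inE; last first.
  by move/(greedy_loop_sub tieP); rewrite inE.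
have leh A : rho A <= budget -> rhoh A <= (1 + theta) * budget.
  (* Chain [rhoh A <= (1 + theta) * rho A] with the budget bound scaled by [1 + theta > 0]. *)
  by have [_ /le_trans leh] := rhohP A => ?; apply: leh; rewrite ler_pM2l ?addr_gt0.
have /prefixP[Y] := greedy_loop_prefix f tie #|S| [::] S leh.
by rewrite inE /greedy /greedy_run => ->; rewrite mem_cat => ->.
Qed.
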